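(* Let $G\subset U(V)$ be a finite complex reflection group and let $k$ be a tuple of complex parameters. The pairing $(\cdot,\cdot)_k$ on $P$ satisfies $$(p,q)_k=\overline{(q,p)_{\overline{k}}}\qquad\text{for all }p,q\in P,$$ where $\overline{k}$ is the tuple of complex conjugates of the entries of $k$.
   Context: $V$ is a finite dimensional complex Hilbert space with inner product $(\cdot,\cdot)$ linear in the second and anti-linear in the first variable. A complex reflection is an element $g\in U(V)$ of finite order such that $\operatorname{Ker}(g-\operatorname{Id})$ is a hyperplane; a finite complex reflection group is a finite subgroup $G\subset U(V)$ generated by complex reflections. For a hyperplane $H$, $G_H\subset G$ is the (cyclic) pointwise stabilizer; $H$ is a reflection hyperplane if $G_H\ne\{\operatorname{Id}\}$, and then $e_H=|G_H|$. $\mathcal{A}$ is the set of reflection hyperplanes, $\mathcal{C}$ the set of $G$-orbits in $\mathcal{A}$; $e_C=e_H$ for $H\in C$. $\chi_H=\det|_{G_H}$. Choose $\alpha_H\in V^*$ with kernel $H$. $P$ is the ring of complex polynomials on $V$, with $G$-action $p^g(x)=p(g^{-1}x)$. Parameters $k=(k_{C,i})$, $k_{C,i}\in\mathbb{C}$, $C\in\mathcal{C}$, $1\le i\le e_C-1$; $k_{H,i}=k_{C,i}$ if $H\in C$. Put $\epsilon_{H,i}=\frac1{e_H}\sum_{g\in G_H}\chi_H^i(g)g$, $a_H(k)=\sum_{i=1}^{e_H-1}e_Hk_{H,i}\epsilon_{H,i}$, and for $\xi\in V$ define on $P$ the operators $$T_\xi(k)=\partial_\xi+\sum_{H\in\mathcal{A}}\alpha_H(\xi)\alpha_H^{-1}a_H(k),$$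 which commute with each other. For $\xi\in V$ let $\xi^*\in V^*$ be $\xi^*(\eta)=(\xi,\eta)$; extend $\xi\mapsto\xi^*$ to an anti-linear ring isomorphism $*:S\to P$ from the symmetric algebra $S$ of $V$, and denote its inverse also by $*$. The linear map $\xi\mapsto T_\xi(k)$ extends to an algebra homomorphism $s\mapsto s(T(k))$ from $S$ to $\operatorname{End}(P)$. The sesquilinear pairing is $(p,q)_k=(p^*(T(k))q)(0)$ for $p,q\in P$. *)

(* Defs.v *)
From HB Require Import structures.
From mathcomp Require Import all_boot all_order all_algebra.
From mathcomp Require Import complex.
From mathcomp Require Import classical_sets reals.
From mathcomp Require Import finmap mpoly.

Set Implicit Arguments.
Unset Strict Implicit.
Unset Printing Implicit Defensive.

Import Order.TTheory GRing.Theory Num.Theory.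
Local Open Scope ring_scope.

Section DunklOperators.
Variables (R : realType) (V : vectType R[i]).
Local Notation n := (\dim {: V}%VS).
Local Notation e_ i := (tnth (vbasis {: V}%VS) i).

(* The ring of polynomials on V and the symmetric algebra of V are both
   represented as polynomial rings in n = dim V indeterminates, relative to the
   basis e_ of V (arbitrary, not assumed orthonormal): 'X_i is the i-th
   coordinate function in [Pol], and the vector [e_ i] itself in [Sym]. *)
Local Notation Pol := {mpoly R[i][n]}.
Local Notation Sym := {mpoly R[i][n]}.

(* Mathcomp's [{dot V for _}] is linear in the first argument and antilinear
   in the second; the inner product here has the opposite convention. *)
Definition inner (dot : {dot V for Num.conj}) (xi eta : V) : R[i] := dot eta xi.

Definition hyperplane (H : {vspace V}) : bool := (\dim H).+1 == n.

Definition unitary (dot : {dot V for Num.conj}) (g : 'End(V)) : Prop :=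
  forall xi eta, inner dot (g xi) (g eta) = inner dot xi eta.

Definition finite_order (g : 'End(V)) : Prop :=
  exists2 m, (0 < m)%N & forall v, iter m g v = v.

Definition complex_reflection (dot : {dot V for Num.conj}) (g : 'End(V)) : Prop :=
  [/\ unitary dot g, finite_order g & hyperplane (fixedSpace g)].

Definition subgroupGL (G : {fset 'End(V)}) : Prop :=
  [/\ \1%VF \in G,
      (forall g h, g \in G -> h \in G -> (g \o h)%VF \in G)
    & forall g, g \in G ->
        exists2 h, h \in G & (h \o g)%VF = \1%VF /\ (g \o h)%VF = \1%VF].

Definition generated_by (G : {fset 'End(V)}) (P : 'End(V) -> Prop) : Prop :=
  forall K : {fset 'End(V)}, subgroupGL K ->
    (forall g, g \in G -> P g -> g \in K) -> {subset G <= K}.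

Definition complex_reflection_group
    (dot : {dot V for Num.conj}) (G : {fset 'End(V)}) : Prop :=
  [/\ subgroupGL G,
      (forall g, g \in G -> unitary dot g)
    & generated_by G (complex_reflection dot)].

Definition pt_stab (G : {fset 'End(V)}) (H : {vspace V}) : {fset 'End(V)} :=
  [fset g in G | (H <= fixedSpace g)%VS]%fset.

Definition stab_order (G : {fset 'End(V)}) (H : {vspace V}) : nat :=
  #|` pt_stab G H|.

Definition reflection_hyperplane (G : {fset 'End(V)}) (H : {vspace V}) : bool :=
  hyperplane H && (pt_stab G H != [fset \1%VF]%fset).

(* A reflection hyperplane is the fixed space of each non-identity element of
   its stabilizer, so these fixed spaces exhaust the arrangement; see
   [mem_arrangement]. *)
Definition arrangement (G : {fset 'End(V)}) : {fset {vspace V}} :=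
  [fset H in [fset fixedSpace g | g in G] | reflection_hyperplane G H]%fset.

Definition orbit_of (G : {fset 'End(V)}) (H : {vspace V}) : {fset {vspace V}} :=
  [fset (g @: H)%VS | g in G]%fset.

Lemma mem_arrangement (G : {fset 'End(V)}) (H : {vspace V}) :
  \1%VF \in G -> (H \in arrangement G) = reflection_hyperplane G H.
Proof.
move=> G1; rewrite /arrangement !inE.
case: (boolP (reflection_hyperplane G H)) => [/andP[hH sH]|_]; last first.
  by rewrite andbF.
rewrite andbT.
have s1 : \1%VF \in pt_stab G H by rewrite !inE G1 fixedSpace_id subvf.
have /fset0Pn[g] : (pt_stab G H `\ \1%VF)%fset != fset0.
  apply: contraNneq sH => s0.
  by rewrite -(fsetD1K s1) s0 fsetU0.
rewrite !inE => /andP[g1 /andP[gG Hg]].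
have nf : fixedSpace g != {: V}%VS.
  apply: contra g1 => /eqP gf; apply/eqP/lfunP => x.
  by rewrite lfunE; apply/fixedSpaceP; rewrite gf memvf.
have HE : H = fixedSpace g.
  apply/eqP; rewrite eqEdim Hg /= -ltnS (eqP hH).
  by rewrite ltn_neqAle dimvS ?subvf // andbT; apply: contra nf => /eqP d;
     rewrite eqEdim subvf d /=.
by rewrite HE; apply/imfsetP; exists g.
Qed.

Definition det_lfun (g : 'End(V)) : R[i] :=
  \det (passmx.mxof (vbasis {: V}%VS) (vbasis {: V}%VS) g).

Definition lform (a : V -> R[i]) : Pol :=
  \sum_(i < n) a (e_ i) *: 'X_i.

Definition vec_coord (i : 'I_n) (v : V) : R[i] :=
  coord (vbasis {: V}%VS) i v.

Definition pol_act (g : 'End(V)) (p : Pol) : Pol :=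
  comp_mpoly [tuple lform (fun v => vec_coord i ((g^-1)%VF v)) | i < n] p.

Definition dirderiv (xi : V) (p : Pol) : Pol :=
  \sum_(i < n) vec_coord i xi *: mderiv i p.

(* The quotient f / d when d divides f (it is then unique for d != 0);
   0 otherwise. *)
Definition exact_quo (d f : Pol) : Pol :=
  xget 0 [set q : Pol | d * q = f]%classic.

Definition eps_op (G : {fset 'End(V)}) (H : {vspace V}) (j : nat) (p : Pol) : Pol :=
  ((stab_order G H)%:R^-1 : R[i]) *:
    \sum_(g <- pt_stab G H) (det_lfun g ^+ j) *: pol_act g p.

(* A parameter tuple assigns [k C j] to each orbit C; only the values with C an
   orbit of reflection hyperplanes and 1 <= j < e_C are ever used. *)
Definition params : Type := {fset {vspace V}} -> nat -> R[i].

Definition conj_params (k : params) : params := fun C j => (k C j)^*.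

Definition a_op (G : {fset 'End(V)}) (k : params) (H : {vspace V}) (p : Pol) : Pol :=
  \sum_(1 <= j < stab_order G H)
    ((stab_order G H)%:R * k (orbit_of G H) j) *: eps_op G H j p.

Definition dunkl (G : {fset 'End(V)}) (alpha : {vspace V} -> 'Hom(V, R[i]^o))
    (k : params) (xi : V) (p : Pol) : Pol :=
  dirderiv xi p
  + \sum_(H <- arrangement G)
      (alpha H xi : R[i]) *: exact_quo (lform (alpha H)) (a_op G k H p).

(* s(T(k)). The operators T_{e_i}(k) commute, so the order in which the factors
   of a monomial are composed is immaterial. *)
Definition dunkl_eval (G : {fset 'End(V)}) (alpha : {vspace V} -> 'Hom(V, R[i]^o))
    (k : params) (s : Sym) (p : Pol) : Pol :=
  \sum_(m <- msupp s) s@_m *: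
    foldr (fun i r => iter (m i) (dunkl G alpha k (e_ i)) r)
          p (enum 'I_n).

(* The antilinear ring morphism sending xi in V to the linear form (xi, -). *)
Definition star (dot : {dot V for Num.conj}) (s : Sym) : Pol :=
  mmap (fun c : R[i] => (c^*)%:MP)
       (fun i => lform (inner dot (e_ i))) s.

(* The inverse of the bijection [star]. *)
Definition star_inv (dot : {dot V for Num.conj}) (p : Pol) : Sym :=
  xget 0 [set s : Sym | star dot s = p]%classic.

Definition pairing (dot : {dot V for Num.conj}) (G : {fset 'End(V)})
    (alpha : {vspace V} -> 'Hom(V, R[i]^o)) (k : params) (p q : Pol) : R[i] :=
  meval (fun=> 0) (dunkl_eval G alpha k (star_inv dot p) q).

End DunklOperators.

(* Main.v *)
Require Import Defs.
From HB Require Import structures.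
From mathcomp Require Import all_boot all_order all_algebra.
From mathcomp Require Import complex.
From mathcomp Require Import classical_sets reals.
From mathcomp Require Import finmap mpoly.
From mathcomp Require Import ssrcomplements ring.

(* Write c_g = sum_j k_(H,j) det(g)^j for a reflection g of G with hyperplane
   H = Ker(g - 1), and xi^* for the linear form (xi, -). The operators satisfy
     T_eta (xi^* p) = xi^* T_eta p + (xi, eta) p
                      + sum_g c_g (xi, g^-1 eta - eta) g.p
   and kill the constants; this is the only information used afterwards, since P
   is generated by the forms xi^*. It gives h T_eta h^-1 = T_(h eta) for h in G
   and then, as g - 1 has rank one, that [T_xi, T_eta] commutes with
   multiplication by linear forms; hence the operators commute and
   (xi^* p, q)_k = (p, T_xi(k) q)_k. The coefficient of g in the relation for k
   and (xi, eta) is conjugate to that of g^-1 in the relation for conj k and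
   (eta, xi), so G-invariance of the pairing and an induction on p yield
   (p, xi^* q)_k = (T_xi(conj k) p, q)_k. The symmetry follows by induction on q. *)

Set Implicit Arguments.
Unset Strict Implicit.
Unset Printing Implicit Defensive.

Import Order.TTheory GRing.Theory Num.Theory.
Local Open Scope ring_scope.

(** * Linear forms and polynomials *)

Section LinearForms.
Variables (R : realType) (V : vectType R[i]).
Local Notation n := (\dim {: V}%VS).
Local Notation e_ i := (tnth (vbasis {: V}%VS) i).
Local Notation Pol := {mpoly R[i][n]}.
Local Notation Dual := 'Hom(V, R[i]^o).

Lemma vec_coordP (v : V) : v = \sum_(i < n) vec_coord i v *: e_ i.
Proof.
rewrite [LHS](coord_vbasis (memvf v)); apply: eq_bigr => i _.
by rewrite (tnth_nth 0).
Qed.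

Lemma vec_coord_vbasis (i j : 'I_n) : vec_coord i (e_ j) = (i == j)%:R.
Proof.
rewrite /vec_coord (tnth_nth 0) eq_sym.
by rewrite coord_free ?(basis_free (vbasisP _)) // eq_sym.
Qed.

Lemma dual_sum (x : Dual) (v : V) :
  x v = \sum_(i < n) vec_coord i v * x (e_ i).
Proof.
by rewrite {1}(vec_coordP v) linear_sum; apply: eq_bigr => i _; rewrite linearZ.
Qed.

Lemma lformD (x y : Dual) : lform (x + y) = lform x + lform y.
Proof.
by rewrite /lform -big_split; apply: eq_bigr => i _; rewrite add_lfunE scalerDl.
Qed.

Lemma lformZ c (x : Dual) : lform (c *: x) = c *: lform x.
Proof.
by rewrite /lform scaler_sumr; apply: eq_bigr => i _; rewrite scale_lfunE scalerA.
Qed.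

Lemma lform_ext (a b : V -> R[i]) : a =1 b -> lform a = lform b.
Proof. by move=> ab; apply: eq_bigr => i _; rewrite ab. Qed.

Lemma mcoeff_lform (a : V -> R[i]) i : (lform a)@_U_(i) = a (e_ i).
Proof.
rewrite /lform raddf_sum /= (bigD1 i) //= mcoeffZ mcoeffX eqxx mulr1.
rewrite big1 ?addr0 // => j /negPf ji; rewrite mcoeffZ mcoeffX.
by rewrite eq_mnm1 ji mulr0.
Qed.

Lemma lform_eq0 (x : Dual) : lform x = 0 -> x = 0.
Proof.
move=> x0; apply/lfunP => v; rewrite lfunE /= dual_sum big1 // => i _.
by rewrite -mcoeff_lform x0 mcoeff0 mulr0.
Qed.

Lemma mderiv_lform (a : V -> R[i]) i : mderiv i (lform a) = (a (e_ i))%:MP.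
Proof.
rewrite /lform raddf_sum /= (bigD1 i) //= mderivZ mderivX mnmE eqxx.
have -> : (U_(i) - U_(i))%MM = 0%MM :> 'X_{1..n}.
  by apply/mnmP => j; rewrite mnmBE subnn mnm0E.
rewrite mpolyX0 scale1r alg_mpolyC.
rewrite big1 ?addr0 // => j /negPf ji; rewrite mderivZ mderivX mnmE ji.
by rewrite scale0r scaler0.
Qed.

Lemma meval_lform (a : V -> R[i]) : (lform a).@[fun=> 0] = 0.
Proof.
by rewrite /lform raddf_sum /= big1 // => j _; rewrite mevalZ mevalXU mulr0.
Qed.

Definition coord_dual (i : 'I_n) : Dual :=
  linfun (coord (vbasis {: V}%VS) i : V -> R[i]^o).

Lemma coord_dualE i v : coord_dual i v = vec_coord i v.
Proof. by rewrite lfunE. Qed.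

Lemma lform_coord_dual i : lform (coord_dual i) = 'X_i.
Proof.
rewrite /lform (bigD1 i) //= coord_dualE vec_coord_vbasis eqxx scale1r.
rewrite big1 ?addr0 // => j /negPf ji.
by rewrite coord_dualE vec_coord_vbasis eq_sym ji scale0r.
Qed.

(** Coordinate functions are linear forms, so every monomial arises from a constant by multiplying
    by forms. Allowing all forms makes the induction independent of the basis. *)
Lemma pol_ind (K : Pol -> Prop) :
  (forall p q, K p -> K q -> K (p + q)) ->
  (forall c, K c%:MP) ->
  (forall (x : Dual) p, K p -> K (lform x * p)) ->
  forall p, K p.
Proof.
move=> KD KC KX p; rewrite [p]mpolyE.
apply: big_ind => //; first by rewrite -mpolyC0; exact: KC.
move=> m _; rewrite -mul_mpolyC mulrC mpolyXE_id.
move: (KC p@_m); move: (p@_m)%:MP => q Kq.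
elim: (index_enum _) => [|i r IH]; first by rewrite big_nil mul1r.
rewrite big_cons -mulrA; move: (_ * q) IH => q' Kq'.
rewrite -lform_coord_dual; elim: (m i) => [|d IHd].
  by rewrite expr0 mul1r.
rewrite exprS -mulrA; exact: KX.
Qed.

Lemma dirderivD xi (p q : Pol) : dirderiv xi (p + q) = dirderiv xi p + dirderiv xi q.
Proof.
rewrite /dirderiv -big_split; apply: eq_bigr => i _.
by rewrite mderivD scalerDr.
Qed.

Lemma dirderivC xi c : dirderiv xi (c%:MP : Pol) = 0.
Proof. by rewrite /dirderiv big1 // => i _; rewrite mderivC scaler0. Qed.

Lemma dirderiv_lformM xi (x : Dual) (p : Pol) :
  dirderiv xi (lform x * p) = lform x * dirderiv xi p + x xi *: p.
Proof.
rewrite /dirderiv addrC mulr_sumr dual_sum scaler_suml -big_split.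
apply: eq_bigr => i _ /=.
by rewrite mderivM mderiv_lform scalerDr mul_mpolyC scalerA scalerAr.
Qed.

Lemma dirderiv_is_linear p : linear (fun xi : V => dirderiv xi p).
Proof.
move=> c u v; rewrite /dirderiv scaler_sumr -big_split.
by apply: eq_bigr => i _; rewrite /vec_coord linearP scalerDl scalerA.
Qed.

Lemma pol_actD g (p q : Pol) : pol_act g (p + q) = pol_act g p + pol_act g q.
Proof. exact: raddfD. Qed.

Lemma pol_actZ g c (p : Pol) : pol_act g (c *: p) = c *: pol_act g p.
Proof. exact: linearZ. Qed.

Lemma pol_actC g c : pol_act g (c%:MP : Pol) = c%:MP.
Proof. exact: comp_mpolyC. Qed.

Lemma pol_actM g (p q : Pol) : pol_act g (p * q) = pol_act g p * pol_act g q.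
Proof. exact: rmorphM. Qed.

Lemma pol_act_lform g (x : Dual) : pol_act g (lform x) = lform (x \o g^-1)%VF.
Proof.
rewrite {1}/lform /pol_act raddf_sum /=.
rewrite (eq_bigr (fun i => x (e_ i) *: lform (fun v => vec_coord i ((g^-1)%VF v))));
  last by move=> i _; rewrite comp_mpolyZ comp_mpolyXU -tnth_nth tnth_mktuple.
rewrite /lform; under eq_bigr do rewrite scaler_sumr.
rewrite exchange_big; apply: eq_bigr => j _ /=.
under eq_bigr do rewrite scalerA.
rewrite -scaler_suml lfunE /= [in RHS]dual_sum; congr (_ *: _).
by apply: eq_bigr => i _; rewrite mulrC.
Qed.

End LinearForms.

(** * The inner product and the star isomorphism *)

Section InnerProduct.
Variables (R : realType) (V : vectType R[i]) (dot : {dot V for Num.conj}).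
Local Notation n := (\dim {: V}%VS).
Local Notation e_ i := (tnth (vbasis {: V}%VS) i).
Local Notation Pol := {mpoly R[i][n]}.
Local Notation Dual := 'Hom(V, R[i]^o).

Lemma inner_linear xi : linear (inner dot xi : V -> R[i]^o).
Proof. by move=> c u v; rewrite /inner linearDl linearZl_LR. Qed.

HB.instance Definition _ xi :=
  GRing.isLinear.Build R[i] V R[i]^o _ (inner dot xi) (inner_linear xi).

Lemma inner_conj u v : (inner dot u v)^* = inner dot v u.
Proof. by rewrite /inner [RHS]hermC /= expr0 mul1r. Qed.

Lemma inner_eq0 u : inner dot u u = 0 -> u = 0.
Proof.
move=> u0; apply/eqP; apply: contraTT isT => nz_u.
by have := neq0_dnorm_gt0 (s := dot) u nz_u; rewrite [dot u u]u0 ltxx.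
Qed.

Lemma innerDl u v w : inner dot (u + v) w = inner dot u w + inner dot v w.
Proof. by rewrite -inner_conj linearD rmorphD /= !inner_conj. Qed.

Lemma innerZl c u w : inner dot (c *: u) w = c^* * inner dot u w.
Proof. by rewrite -inner_conj linearZ rmorphM /= inner_conj. Qed.

Lemma innerZr c u w : inner dot u (c *: w) = c * inner dot u w.
Proof. exact: linearZ. Qed.

Lemma innerDr u v w : inner dot u (v + w) = inner dot u v + inner dot u w.
Proof. exact: linearD. Qed.

Lemma innerBr u v w : inner dot u (v - w) = inner dot u v - inner dot u w.
Proof. exact: linearB. Qed.

Lemma inner_sumr (I : Type) (r : seq I) (F : I -> V) u :
  inner dot u (\sum_(i <- r) F i) = \sum_(i <- r) inner dot u (F i).
Proof. exact: linear_sum. Qed.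

Definition rieszf (xi : V) : Dual := linfun (inner dot xi : V -> R[i]^o).

Lemma rieszfE xi v : rieszf xi v = inner dot xi v.
Proof. by rewrite lfunE. Qed.

Lemma lform_riesz xi : lform (rieszf xi) = lform (inner dot xi).
Proof. by apply: lform_ext => v; rewrite rieszfE. Qed.

Lemma inner_inj_basis u : (forall i, inner dot (e_ i) u = 0) -> u = 0.
Proof.
move=> u0; apply: inner_eq0.
rewrite {2}(vec_coordP u) inner_sumr big1 // => i _.
by rewrite innerZr -inner_conj u0 conjC0 mulr0.
Qed.

Definition gram (u : V) : V := \sum_(i < n) inner dot (e_ i) u *: e_ i.

Lemma gram_linear : linear gram.
Proof.
move=> c u v; rewrite /gram scaler_sumr -big_split; apply: eq_bigr => i _ /=.
by rewrite innerDr innerZr scalerDl scalerA.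
Qed.

HB.instance Definition _ := GRing.isLinear.Build R[i] V V _ gram gram_linear.

Lemma vec_coord_sum (a : 'I_n -> R[i]) i :
  vec_coord i (\sum_(j < n) a j *: e_ j) = a i.
Proof.
rewrite /vec_coord linear_sum (bigD1 i) //= linearZ /= -/(vec_coord _ _).
rewrite vec_coord_vbasis eqxx mulr1 big1 ?addr0 // => j /negPf ji.
by rewrite linearZ /= -/(vec_coord _ _) vec_coord_vbasis eq_sym ji mulr0.
Qed.

(** The Gram map is injective because the inner product is definite, hence invertible in finite
    dimension. *)
Lemma riesz (x : Dual) : exists xi, x = rieszf xi.
Proof.
have ker0 : lker (linfun gram) == 0%VS.
  rewrite -subv0; apply/subvP => u; rewrite memv_ker memv0 lfunE /= => /eqP u0.
  apply/eqP; apply: inner_inj_basis => i.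
  rewrite -[LHS](vec_coord_sum (fun j => inner dot (e_ j) u)) -/(gram u) u0.
  by rewrite /vec_coord linear0.
(* The values are conjugated because [gram] records (e_i, xi), while the form [rieszf xi] takes the
   value (xi, e_i). *)
pose w := \sum_(i < n) (x (e_ i))^* *: e_ i.
pose xi := ((linfun gram)^-1)%VF w.
have gxi : gram xi = w by rewrite -[LHS]lfunE /= lker0_lfunVK.
exists xi; apply/lfunP => v; rewrite !dual_sum; apply: eq_bigr => i _.
congr (_ * _); rewrite rieszfE -inner_conj.
rewrite -(vec_coord_sum (fun j => inner dot (e_ j) xi)) -/(gram xi) gxi.
by rewrite vec_coord_sum conjCK.
Qed.

Lemma pol_ind_riesz (K : Pol -> Prop) :
  (forall p q, K p -> K q -> K (p + q)) ->
  (forall c, K c%:MP) ->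
  (forall xi p, K p -> K (lform (inner dot xi) * p)) ->
  forall p, K p.
Proof.
move=> KD KC KX; apply: pol_ind => // x p Kp.
by have [xi ->] := riesz x; rewrite lform_riesz; apply: KX.
Qed.

(** The vector v in degree one of the symmetric algebra, where 'X_i stands for the basis vector e_i
    and not for a coordinate function. *)
Definition symvec (v : V) : Pol := \sum_(i < n) vec_coord i v *: 'X_i.

(** Packaging the coefficient map of [star] as a ring morphism makes the morphism lemmas for [mmap]
    available. *)
Definition conjC_mpoly : {rmorphism R[i] -> Pol} :=
  @mpolyC n R[i] \o Num.conj.

Lemma starE : star dot = mmap conjC_mpoly (fun i => lform (inner dot (e_ i))).
Proof. by []. Qed.

Lemma starM s t : star dot (s * t) = star dot s * star dot t.
Proof. by rewrite starE rmorphM. Qed.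

Lemma starD s t : star dot (s + t) = star dot s + star dot t.
Proof. by rewrite starE raddfD. Qed.

Lemma starC c : star dot c%:MP = (c^*)%:MP.
Proof. by rewrite starE mmapC. Qed.

Lemma starX i : star dot 'X_i = lform (inner dot (e_ i)).
Proof. by rewrite starE mmapX mmap1U. Qed.

Lemma starZ c s : star dot (c *: s) = c^* *: star dot s.
Proof. by rewrite -!mul_mpolyC starM starC. Qed.

Lemma star_sum (I : Type) (r : seq I) (F : I -> Pol) :
  star dot (\sum_(i <- r) F i) = \sum_(i <- r) star dot (F i).
Proof. by apply: big_morph; [exact: starD | rewrite -mpolyC0 starC conjC0]. Qed.

Lemma star_symvec v : star dot (symvec v) = lform (inner dot v).
Proof.
rewrite /symvec star_sum /lform.
under eq_bigr do rewrite starZ starX /lform scaler_sumr.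
rewrite exchange_big; apply: eq_bigr => j _ /=.
under eq_bigr do rewrite scalerA.
rewrite -scaler_suml; congr (_ *: _).
rewrite [in RHS](vec_coordP v) -[RHS]inner_conj inner_sumr rmorph_sum.
by apply: eq_bigr => i _; rewrite innerZr rmorphM /= inner_conj.
Qed.

Lemma symvecZ c v : symvec (c *: v) = c *: symvec v.
Proof.
rewrite /symvec scaler_sumr; apply: eq_bigr => i _.
by rewrite /vec_coord linearZ scalerA.
Qed.

Lemma symvec_vbasis i : symvec (e_ i) = 'X_i.
Proof.
rewrite /symvec (bigD1 i) //= vec_coord_vbasis eqxx scale1r.
rewrite big1 ?addr0 // => j /negPf ji.
by rewrite vec_coord_vbasis ji scale0r.
Qed.

Lemma sym_ind (K : Pol -> Prop) :
  (forall s t, K s -> K t -> K (s + t)) ->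
  (forall c, K c%:MP) ->
  (forall v s, K s -> K (symvec v * s)) ->
  forall s, K s.
Proof.
move=> KD KC KX; apply: pol_ind => // x p Kp.
rewrite /lform mulr_suml; apply: big_ind => //.
  by rewrite -mpolyC0; apply: KC.
by move=> i _; rewrite -symvec_vbasis -symvecZ; apply: KX.
Qed.

Lemma star_surj p : exists s, star dot s = p.
Proof.
elim/pol_ind_riesz: p => [p q [s <-] [t <-]|c|xi p [s <-]].
- by exists (s + t); rewrite starD.
- by exists (c^*)%:MP; rewrite starC conjCK.
- by exists (symvec xi * s); rewrite starM star_symvec.
Qed.

(** An explicit left inverse is built: the antilinear ring morphism sending 'X_i to the Riesz vector
    of the i-th coordinate function. *)
Lemma star_inj : injective (star dot).
Proof.
have /fin_all_exists[zeta zetaP] i : exists z, coord_dual i = rieszf z by exact: riesz.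
pose unstar : Pol -> Pol := mmap conjC_mpoly (fun i => symvec (zeta i)).
have zeta_e i j : inner dot (zeta i) (e_ j) = (i == j)%:R.
  by rewrite -rieszfE -zetaP coord_dualE vec_coord_vbasis.
(* The zeta_j form the basis dual to the e_j, so both sides have the same inner product with each
   e_i. *)
have expand v : v = \sum_(j < n) inner dot (e_ j) v *: zeta j.
  apply/eqP; rewrite -subr_eq0; apply/eqP; apply: inner_inj_basis => i.
  rewrite innerBr inner_sumr (bigD1 i) //= innerZr -(inner_conj (zeta i)).
  rewrite zeta_e eqxx rmorph1 mulr1 big1 ?addr0 ?subrr // => j /negPf ji.
  by rewrite innerZr -(inner_conj (zeta j)) zeta_e ji rmorph0 mulr0.
have unD s t : unstar (s + t) = unstar s + unstar t by exact: raddfD.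
have unM s t : unstar (s * t) = unstar s * unstar t by exact: rmorphM.
have unC c : unstar c%:MP = (c^*)%:MP by exact: mmapC.
have unX i : unstar 'X_i = symvec (zeta i) by rewrite /unstar mmapX mmap1U.
clearbody unstar.
have unl v : unstar (lform (inner dot v)) = symvec v.
  rewrite /lform (big_morph unstar unD (_ : unstar 0 = 0)); last first.
    by rewrite -mpolyC0 unC conjC0.
  under eq_bigr do rewrite -mul_mpolyC unM unC unX mul_mpolyC inner_conj.
  rewrite {2}(expand v) /symvec.
  under [RHS]eq_bigr do rewrite /vec_coord linear_sum scaler_suml.
  rewrite exchange_big; apply: eq_bigr => j _ /=.
  rewrite scaler_sumr.
  by apply: eq_bigr => i _; rewrite scalerA /vec_coord [in RHS]linearZ.
suff /can_inj : cancel (star dot) unstar by [].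
apply: sym_ind => [s t ss tt|c|u s IH].
- by rewrite starD unD; congr (_ + _).
- by rewrite starC unC conjCK.
by rewrite starM star_symvec unM unl; congr (_ * _).
Qed.

Lemma star_invP p : star dot (star_inv dot p) = p.
Proof. exact: (xgetPex 0 (star_surj p)). Qed.

Lemma star_inv_star s : star_inv dot (star dot s) = s.
Proof. by apply: star_inj; rewrite star_invP. Qed.

Lemma star_invD p q : star_inv dot (p + q) = star_inv dot p + star_inv dot q.
Proof. by rewrite -{1}(star_invP p) -{1}(star_invP q) -starD star_inv_star. Qed.

Lemma star_invZ c p : star_inv dot (c *: p) = c^* *: star_inv dot p.
Proof. by rewrite -{1}(star_invP p) -{1}[c]conjCK -starZ star_inv_star. Qed.

Lemma star_inv1 : star_inv dot 1 = 1.
Proof.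
by rewrite -[X in star_inv _ X = _]mpolyC1 -conjC1 -starC star_inv_star mpolyC1.
Qed.

Lemma star_inv_innerM u p :
  star_inv dot (lform (inner dot u) * p) = symvec u * star_inv dot p.
Proof. by rewrite -{1}(star_invP p) -star_symvec -starM star_inv_star. Qed.

End InnerProduct.

(** * Determinants of rank-one perturbations *)

(** Sylvester's identity, read off from two block triangular factorisations of one and the same
    matrix. *)
Lemma det1_mulC (F : comNzRingType) m p (A : 'M[F]_(m, p)) (B : 'M[F]_(p, m)) :
  \det (1%:M + A *m B) = \det (1%:M + B *m A).
Proof.
have e1 : block_mx 1%:M (- A) 0 1%:M *m block_mx (1%:M + A *m B) 0 B 1%:M
  = block_mx 1%:M (- A) B 1%:M.
  by rewrite mulmx_block !(mul1mx, mulmx1, mul0mx, mulmx0, mulNmx, add0r, addrK).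
have e2 : block_mx 1%:M 0 B 1%:M *m block_mx 1%:M (- A) 0 (1%:M + B *m A)
  = block_mx 1%:M (- A) B 1%:M.
  rewrite mulmx_block !(mul1mx, mulmx1, mul0mx, mulmx0, mulmxN, addr0).
  by rewrite addrC addrK.
move: (congr1 determinant e1); rewrite -e2 !det_mulmx !det_ublock !det_lblock.
by rewrite !det1 !mul1r !mulr1.
Qed.

(** An injective self-map of a finite set is onto. This serves for translation, conjugation and
    inversion in the group. *)
Lemma sum_fset_reindex (M : nmodType) (T : choiceType) (A : {fset T}) (f : T -> T)
    (F : T -> M) :
  {in A &, injective f} -> (forall x, x \in A -> f x \in A) ->
  \sum_(x <- A) F (f x) = \sum_(x <- A) F x.
Proof.
move=> f_inj fA.
have {2}-> : A = (f @` A)%fset.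
  apply/eqP; rewrite eq_sym eqEfcard card_in_imfset // leqnn andbT.
  by apply/fsubsetP => _ /imfsetP[x xA ->]; apply: fA.
by rewrite big_imfset.
Qed.

Section Determinant.
Variables (R : realType) (V : vectType R[i]).
Local Notation n := (\dim {: V}%VS).
Local Notation e_ i := (tnth (vbasis {: V}%VS) i).
Local Notation Dual := 'Hom(V, R[i]^o).

Lemma det_lfunM (g h : 'End(V)) : det_lfun (g \o h)%VF = det_lfun g * det_lfun h.
Proof.
by rewrite /det_lfun (passmx.mxof_comp _ _ (vbasisP _)) det_mulmx mulrC.
Qed.

Lemma det_lfun1 : det_lfun (\1%VF : 'End(V)) = 1.
Proof.
by rewrite /det_lfun passmx.mxof1 ?det1 // (basis_free (vbasisP _)).
Qed.

(** In coordinates g is the identity plus a column times a row, and [det1_mulC] reduces the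
    determinant to size one. *)
Lemma det_rank1 (g : 'End(V)) (a : Dual) v :
  (forall u, g u = u + a u *: v) -> det_lfun g = 1 + a v.
Proof.
move=> gE; rewrite /det_lfun.
have -> : passmx.mxof (vbasis fullv) (vbasis fullv) g =
    1%:M + (\col_i a (e_ i)) *m passmx.rVof (vbasis fullv) v.
  apply/matrixP => i j; rewrite !mxE big_ord1 !mxE /= passmx.vecof_delta.
  rewrite -(tnth_nth 0) gE linearD linearZ /=.
  by rewrite -!/(vec_coord _ _) vec_coord_vbasis eq_sym.
rewrite det1_mulC det_mx11 !mxE eqxx; congr (_ + _).
by rewrite dual_sum; apply: eq_bigr => i _; rewrite !mxE.
Qed.

End Determinant.

(** * Finite unitary groups *)

Section ReflectionGroup.
Variables (R : realType) (V : vectType R[i]) (dot : {dot V for Num.conj}).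
Variable (G : {fset 'End(V)}).
Hypothesis subG : subgroupGL G.
Hypothesis unitaryG : forall g, g \in G -> unitary dot g.
Local Notation n := (\dim {: V}%VS).
Local Notation Pol := {mpoly R[i][n]}.
Local Notation Dual := 'Hom(V, R[i]^o).

Lemma GL_group1 : \1%VF \in G. Proof. by case: subG. Qed.

Lemma GL_groupM g h : g \in G -> h \in G -> (g \o h)%VF \in G.
Proof. by case: subG => _ + _; apply. Qed.

(** Inversion is a total operation on endomorphisms; triviality of the kernel makes it the true
    inverse on [G]. *)
Lemma GL_group_lker0 g : g \in G -> lker g == 0%VS.
Proof.
case: subG => _ _ H /H[h _ [hg _]]; apply/lker0P => u v guv.
by rewrite -[u]id_lfunE -[v]id_lfunE -hg !comp_lfunE guv.
Qed.

Lemma GL_groupV g : g \in G -> (g^-1)%VF \in G.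
Proof.
move=> gG; case: subG => _ _ /(_ g gG)[h hG [_ gh]].
suff -> : (g^-1)%VF = h by [].
by rewrite -(comp_lfun1r (g^-1)) -gh comp_lfunA lker0_compVf ?GL_group_lker0 ?comp_lfun1l.
Qed.

Lemma GL_groupK g : g \in G -> cancel g (g^-1)%VF.
Proof. by move=> /GL_group_lker0; apply: lker0_lfunK. Qed.

Lemma GL_groupVK g : g \in G -> cancel (g^-1)%VF g.
Proof. by move=> /GL_group_lker0; apply: lker0_lfunVK. Qed.

Lemma GL_group_invP (g h : 'End(V)) : g \in G -> (forall u, g (h u) = u) -> h = (g^-1)%VF.
Proof. by move=> gG gh; apply/lfunP => u; rewrite -[h u](GL_groupK gG) gh. Qed.

Lemma GL_groupM_inv g h : g \in G -> h \in G -> ((g \o h)^-1 = h^-1 \o g^-1)%VF.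
Proof.
move=> gG hG; apply/esym/GL_group_invP; first exact: GL_groupM.
by move=> u; rewrite !comp_lfunE GL_groupVK // GL_groupVK.
Qed.

Lemma GL_group_invK g : g \in G -> ((g^-1)^-1 = g)%VF.
Proof. by move=> gG; apply/esym/GL_group_invP; [exact: GL_groupV | exact: GL_groupK]. Qed.

Lemma inner_group g u v : g \in G -> inner dot (g u) (g v) = inner dot u v.
Proof. by move=> gG; apply: unitaryG. Qed.

Lemma inner_groupV g u v : g \in G -> inner dot u (g^-1 v)%VF = inner dot (g u) v.
Proof. by move=> gG; rewrite -(inner_group _ _ gG) GL_groupVK. Qed.

(** Unitarity turns the contragredient action on forms into the action on the vectors that represent
    them. *)
Lemma pol_act_riesz g u : g \in G ->
  pol_act g (lform (inner dot u)) = lform (inner dot (g u)).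
Proof.
move=> gG; rewrite -lform_riesz pol_act_lform; apply: lform_ext => v.
by rewrite comp_lfunE /= rieszfE inner_groupV.
Qed.

Lemma pol_act_comp g h (p : Pol) : g \in G -> h \in G ->
  pol_act g (pol_act h p) = pol_act (g \o h)%VF p.
Proof.
move=> gG hG; elim/pol_ind: p => [p q IHp IHq|c|x p IH].
- rewrite (pol_actD h) (pol_actD g) (pol_actD (g \o h)).
  exact: (congr2 +%R IHp IHq).
- by rewrite (pol_actC h) (pol_actC g) (pol_actC (g \o h)).
rewrite (pol_actM h) (pol_actM g) (pol_actM (g \o h)).
rewrite (pol_act_lform h x) (pol_act_lform g _) (pol_act_lform (g \o h) x).
rewrite (GL_groupM_inv gG hG) comp_lfunA.
exact: (congr1 ( *%R _) IH).
Qed.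

Lemma fixedSpaceV g : g \in G -> fixedSpace (g^-1)%VF = fixedSpace g.
Proof.
move=> gG; apply/vspaceP => u; apply/fixedSpaceP/fixedSpaceP => gu.
  by rewrite -{1}gu GL_groupVK.
by rewrite -{1}gu GL_groupK.
Qed.

Definition conj_lfun (h g : 'End(V)) : 'End(V) := (h \o g \o h^-1)%VF.

Lemma conj_lfun_in h g : h \in G -> g \in G -> conj_lfun h g \in G.
Proof. by move=> hG gG; rewrite !GL_groupM ?GL_groupV. Qed.

Lemma conj_lfun_inj h : h \in G -> injective (conj_lfun h).
Proof.
move=> hG g1 g2 /lfunP eq12; apply/lfunP => u.
have := eq12 (h u); rewrite !comp_lfunE /= !GL_groupK //.
by move/(can_inj (GL_groupK hG)).
Qed.

Lemma conj_lfunK h g : h \in G -> (conj_lfun h g \o h)%VF = (h \o g)%VF.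
Proof. by move=> hG; apply/lfunP => u; rewrite !comp_lfunE /= GL_groupK. Qed.

Lemma conj_lfunV h g : h \in G -> g \in G -> ((conj_lfun h g)^-1 = conj_lfun h g^-1)%VF.
Proof.
move=> hG gG; apply/esym/GL_group_invP; first exact: conj_lfun_in.
by move=> u; rewrite !comp_lfunE /= GL_groupK // GL_groupVK // GL_groupVK.
Qed.

Lemma fixedSpace_conj_lfun h g : h \in G ->
  fixedSpace (conj_lfun h g) = (h @: fixedSpace g)%VS.
Proof.
move=> hG; apply/vspaceP => u; apply/fixedSpaceP/idP.
  rewrite !comp_lfunE /= => hu; rewrite -(GL_groupVK hG u); apply: memv_img.
  by apply/fixedSpaceP; apply: (can_inj (GL_groupK hG)); rewrite GL_groupVK.
case/memv_imgP => w /fixedSpaceP gw ->.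
by rewrite !comp_lfunE /= GL_groupK // gw.
Qed.

Lemma hyperplane_img h H : h \in G -> hyperplane (h @: H)%VS = hyperplane H.
Proof.
move=> hG; rewrite /hyperplane limg_dim_eq //.
by rewrite (eqP (GL_group_lker0 hG)) capv0.
Qed.

Lemma pt_stab_img h H : h \in G ->
  pt_stab G (h @: H)%VS = (conj_lfun h @` pt_stab G H)%fset.
Proof.
move=> hG; apply/fsetP => g; apply/idP/imfsetP => /=.
  rewrite !inE /= => /andP[gG]; have hVG := GL_groupV hG.
  have gE : g = conj_lfun h (conj_lfun (h^-1)%VF g).
    by apply/lfunP => u; rewrite !comp_lfunE /= GL_group_invK // !GL_groupVK.
  rewrite {1}gE fixedSpace_conj_lfun // limg_ker0 ?GL_group_lker0 // => sH.
  by exists (conj_lfun (h^-1)%VF g); rewrite // !inE conj_lfun_in.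
case=> g'; rewrite !inE /= => /andP[g'G sH] ->.
apply/andP; split; first exact: conj_lfun_in.
by rewrite (fixedSpace_conj_lfun _ hG) limgS.
Qed.

Lemma stab_order_img h H : h \in G -> stab_order G (h @: H)%VS = stab_order G H.
Proof.
by move=> hG; rewrite /stab_order pt_stab_img // card_imfset //; apply: conj_lfun_inj.
Qed.

Lemma orbit_of_img h H : h \in G -> orbit_of G (h @: H)%VS = orbit_of G H.
Proof.
move=> hG; apply/fsetP => K; apply/imfsetP/imfsetP => -[g /= gG ->].
  by exists (g \o h)%VF; rewrite ?GL_groupM ?limg_comp.
exists (g \o h^-1)%VF; first by rewrite /= GL_groupM ?GL_groupV.
by rewrite -limg_comp -comp_lfunA lker0_compVf ?GL_group_lker0 ?comp_lfun1r.
Qed.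

Lemma det_lfun_neq0 g : g \in G -> det_lfun g != 0.
Proof.
move=> gG; have : det_lfun g * det_lfun (g^-1)%VF = 1.
  by rewrite -det_lfunM lker0_compfV ?GL_group_lker0 // det_lfun1.
by move=> e; apply: contra_eq_neq e => ->; rewrite mul0r eq_sym oner_eq0.
Qed.

Lemma det_lfunV g : g \in G -> det_lfun (g^-1)%VF = (det_lfun g)^-1.
Proof.
move=> gG; apply: (mulfI (det_lfun_neq0 gG)).
by rewrite -det_lfunM lker0_compfV ?GL_group_lker0 // det_lfun1 divff ?det_lfun_neq0.
Qed.

Lemma det_conj_lfun h g : h \in G -> g \in G -> det_lfun (conj_lfun h g) = det_lfun g.
Proof.
move=> hG gG; rewrite /conj_lfun !det_lfunM det_lfunV // mulrAC divff ?mul1r //.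
exact: det_lfun_neq0.
Qed.

(** If a w = 1, then u - a(u) w lies in the kernel of a and is fixed by g, so the displacement of u
    is a(u) times that of w. *)
Lemma rank1P (a : Dual) (g : 'End(V)) : a != 0 -> (lker a <= fixedSpace g)%VS ->
  exists v, forall u, g u = u + a u *: v.
Proof.
move=> nz_a sag; have [w aw] : exists w, a w = 1.
  case: (pickP (fun i => a (tnth (vbasis fullv) i) != 0)) => [i ai|a0].
    by exists ((a (tnth (vbasis fullv) i))^-1 *: tnth (vbasis fullv) i);
       rewrite linearZ /= [LHS]mulVf.
  case/eqP: nz_a; apply/lfunP => u; rewrite dual_sum big1 ?lfunE // => i _.
  by rewrite (eqP (negbFE (a0 i))) mulr0.
exists (g w - w) => u.
have : u - a u *: w \in lker a.
  by rewrite memv_ker linearB linearZ /= aw [_ *: _]mulr1 subrr.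
move/(subvP sag)/fixedSpaceP; rewrite linearB linearZ /= => e.
by rewrite scalerBr addrC -addrA [_ + u]addrC -e addrC subrK.
Qed.

(** A nonzero v is an eigenvector with eigenvalue 1 + a v = det g, and eigenvalues of unitary maps
    have modulus one. *)
Lemma unitary_rank1_det g (a : Dual) v : g \in G ->
  (forall u, g u = u + a u *: v) -> (det_lfun g)^* * det_lfun g = 1.
Proof.
move=> gG gE; rewrite (det_rank1 gE).
have [->|nz_v] := eqVneq v 0; first by rewrite linear0 addr0 conjC1 mul1r.
have gv : g v = (1 + a v) *: v by rewrite gE scalerDl scale1r.
have := inner_group v v gG; rewrite gv innerZl innerZr mulrA.
rewrite -[RHS]mul1r; apply: mulIf; apply: contraNneq nz_v => /inner_eq0 ->.
by [].
Qed.

(** Determinant one gives a v = 0, so g fixes v. Comparing (g u, g v) with (u, v) leaves conj(a u)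
    (v, v) = 0, hence no displacement. *)
Lemma unitary_transvection g (a : Dual) v : g \in G ->
  (forall u, g u = u + a u *: v) -> det_lfun g = 1 -> g = \1%VF.
Proof.
move=> gG gE; rewrite (det_rank1 gE) -{2}[1]addr0 => /addrI av.
have gv : g v = v by rewrite gE av scale0r addr0.
apply/lfunP => u; rewrite id_lfunE gE.
have := inner_group u v gG; rewrite gv gE innerDl innerZl -{2}[inner _ _ _]addr0.
move/addrI/eqP; rewrite mulf_eq0 conjC_eq0 => /orP[/eqP->|/eqP/inner_eq0->].
  by rewrite scale0r addr0.
by rewrite scaler0 addr0.
Qed.

End ReflectionGroup.

(** * Pointwise stabilizers of hyperplanes and their determinant characters *)

Section Stabilizers.
Variables (R : realType) (V : vectType R[i]) (dot : {dot V for Num.conj}).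
Variable (G : {fset 'End(V)}).
Hypothesis subG : subgroupGL G.
Hypothesis unitaryG : forall g, g \in G -> unitary dot g.
Local Notation n := (\dim {: V}%VS).
Local Notation Pol := {mpoly R[i][n]}.
Local Notation Dual := 'Hom(V, R[i]^o).

(** Polynomials form an integral domain, so the quotient picked by [xget] can only be q. *)
Lemma exact_quoP (d f q : Pol) : d != 0 -> d * q = f -> exact_quo d f = q.
Proof.
move=> nz_d dq; rewrite /exact_quo; case: xgetP => [q' _ /= dq'|]; last first.
  by move/(_ q).
by apply: (mulfI nz_d); rewrite dq' dq.
Qed.

Lemma hyperplane_neq0 (a : Dual) H : hyperplane H -> lker a = H -> a != 0.
Proof.
move=> hH aH; apply: contraTneq hH => a0.
rewrite /hyperplane -aH (_ : lker a = fullv) ?neq_ltn ?ltnSn ?orbT //.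
by apply/vspaceP => u; rewrite memvf memv_ker a0 lfunE /= eqxx.
Qed.

Lemma pt_stabP g H :
  reflect (g \in G /\ (H <= fixedSpace g)%VS) (g \in pt_stab G H).
Proof. by rewrite !inE; apply: andP. Qed.

Lemma pt_stabM g h H : g \in pt_stab G H -> h \in pt_stab G H ->
  (g \o h)%VF \in pt_stab G H.
Proof.
move=> /pt_stabP[gG /fixedSpacesP gH] /pt_stabP[hG /fixedSpacesP hH].
apply/pt_stabP; split; first exact: GL_groupM.
by apply/fixedSpacesP => u uH; rewrite comp_lfunE /= hH // gH.
Qed.

Lemma pt_stabV g H : g \in pt_stab G H -> (g^-1)%VF \in pt_stab G H.
Proof.
move=> /pt_stabP[gG gH]; apply/pt_stabP; split; first exact: GL_groupV.
by rewrite (fixedSpaceV subG).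
Qed.

Section Hyperplane.
Variables (a : Dual) (H : {vspace V}).
Hypotheses (hypH : hyperplane H) (kerH : lker a = H).

Lemma pt_stab_rank1 g : g \in pt_stab G H ->
  exists v, forall u, g u = u + a u *: v.
Proof.
move=> /pt_stabP[gG gH]; apply: rank1P; first exact: hyperplane_neq0 hypH kerH.
by rewrite kerH.
Qed.

(* det is faithful on G_H: an element of determinant 1 is a unitary
   transvection. *)
Lemma det_pt_stab_inj : {in pt_stab G H &, injective (@det_lfun R V)}.
Proof.
move=> g h gS hS dgh; have [gG _] := pt_stabP _ _ gS.
have fS : (g^-1 \o h)%VF \in pt_stab G H by rewrite pt_stabM ?pt_stabV.
have [v fE] := pt_stab_rank1 fS; have [fG _] := pt_stabP _ _ fS.
have f1 : (g^-1 \o h)%VF = \1%VF.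
  apply: (unitary_transvection unitaryG fG fE).
  by rewrite det_lfunM (det_lfunV subG gG) dgh mulVf // -dgh (det_lfun_neq0 subG gG).
by rewrite -[h]comp_lfun1l -(lker0_compfV (GL_group_lker0 subG gG)) -comp_lfunA f1 comp_lfun1r.
Qed.

(** Character orthogonality: translating the sum by an element g multiplies it by det(g)^j, which
    differs from 1 for a suitable g. *)
Lemma sum_det_pt_stab j : (0 < j < stab_order G H)%N ->
  \sum_(g <- pt_stab G H) det_lfun g ^+ j = 0 :> R[i].
Proof.
case/andP=> j_gt0 ltj.
(* Otherwise X^j - 1 would have as roots the determinants of all elements of the stabilizer, which
   are pairwise distinct and more than j in number. *)
have [g gS gj] : exists2 g, g \in pt_stab G H & det_lfun g ^+ j != 1.
  apply/hasP; rewrite -[has _ _]negbK -all_predC; apply/negP => /allP all1.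
  have sz : size ('X^j - 1%:P : {poly R[i]}) = j.+1 by rewrite size_XnsubC.
  suff : (size (map (@det_lfun R V) (pt_stab G H)) < j.+1)%N.
    by rewrite size_map ltnS leqNgt ltj.
  rewrite -sz; apply: max_poly_roots.
  - by rewrite -size_poly_eq0 sz.
  - apply/allP => _ /mapP[g gS ->]; rewrite /root !hornerE subr_eq0.
    by have := all1 g gS; rewrite /= negbK.
  by rewrite map_inj_in_uniq ?fset_uniq //; apply: det_pt_stab_inj.
have [gG _] := pt_stabP _ _ gS.
set S := \sum_(_ <- _) _.
have : S = det_lfun g ^+ j * S.
  rewrite {1}/S -(@sum_fset_reindex _ _ _ (fun h => g \o h)%VF).
  - by rewrite mulr_sumr; apply: eq_bigr => h _; rewrite det_lfunM exprMn.
  - move=> h1 h2 _ _ e; rewrite -[h1](lker0_compKf (GL_group_lker0 subG gG)) e.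
    by rewrite (lker0_compKf (GL_group_lker0 subG gG)).
  - by move=> h hS; apply: pt_stabM.
move/eqP; rewrite -subr_eq0 -{1}[S]mul1r -mulrBl mulf_eq0 subr_eq0 eq_sym.
by rewrite (negPf gj) => /eqP.
Qed.
End Hyperplane.
End Stabilizers.

(** * Divided differences along a hyperplane *)

Section HyperplaneQuotients.
Variables (R : realType) (V : vectType R[i]) (dot : {dot V for Num.conj}).
Variable (G : {fset 'End(V)}).
Hypothesis subG : subgroupGL G.
Hypothesis unitaryG : forall g, g \in G -> unitary dot g.
Local Notation n := (\dim {: V}%VS).
Local Notation Pol := {mpoly R[i][n]}.
Local Notation Dual := 'Hom(V, R[i]^o).

(** The coefficient of g in a_H(k): the factor e_H of [a_op] cancels the 1/e_H of [eps_op]. *)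
Definition stab_coef (k : params V) (H : {vspace V}) (g : 'End(V)) : R[i] :=
  \sum_(1 <= j < stab_order G H) k (orbit_of G H) j * det_lfun g ^+ j.

Lemma a_opE (k : params V) H p :
  a_op G k H p = \sum_(g <- pt_stab G H) stab_coef k H g *: pol_act g p.
Proof.
have nz_e : (stab_order G H)%:R != 0 :> R[i].
  rewrite pnatr_eq0 cardfs_eq0; apply/fset0Pn; exists \1%VF.
  by apply/pt_stabP; rewrite fixedSpace_id subvf (GL_group1 subG).
rewrite /a_op /eps_op.
under eq_bigr do rewrite scalerA mulrAC divff // mul1r scaler_sumr.
rewrite exchange_big; apply: eq_bigr => g _ /=.
by rewrite scaler_suml; apply: eq_bigr => j _; rewrite scalerA.
Qed.

Lemma a_opD k H p q : a_op G k H (p + q) = a_op G k H p + a_op G k H q.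
Proof.
rewrite !a_opE -big_split; apply: eq_bigr => g _ /=.
by rewrite pol_actD scalerDr.
Qed.

Section Hyperplane.
Variables (a : Dual) (H : {vspace V}) (k : params V).
Hypotheses (hypH : hyperplane H) (kerH : lker a = H).

Lemma lform_hyperplane_neq0 : lform a != 0.
Proof.
apply: contra (hyperplane_neq0 hypH kerH) => /eqP a0.
by apply/eqP/lform_eq0.
Qed.

(** Only the nontrivial characters det^j with 0 < j < e_H occur. This is why a_H(k) kills the
    constants. *)
Lemma sum_stab_coef : \sum_(g <- pt_stab G H) stab_coef k H g = 0.
Proof.
rewrite /stab_coef exchange_big big_nat big1 //= => j hj.
by rewrite -mulr_sumr (sum_det_pt_stab subG unitaryG hypH kerH) // mulr0.
Qed.

Lemma a_opC c : a_op G k H c%:MP = 0.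
Proof.
rewrite a_opE; under eq_bigr do rewrite pol_actC.
by rewrite -scaler_suml sum_stab_coef scale0r.
Qed.

Lemma pt_stab_quotient g : g \in pt_stab G H -> forall x : Dual,
  exists t, (x \o g^-1)%VF = x + t *: a.
Proof.
move=> gS x; have [v gE] := pt_stab_rank1 hypH kerH (pt_stabV subG gS).
exists (x v); apply/lfunP => u.
rewrite comp_lfunE /= gE add_lfunE scale_lfunE linearD linearZ /=.
by congr (_ + _); apply: mulrC.
Qed.

(** Each g of the stabilizer sends x to x + t_g a, so a_H(x p) is x a_H(p) plus a visible multiple
    of a. The second conclusion is scaled by a(xi) to replace a(xi) t_g by a difference of values of
    x. *)
Lemma a_op_lformM (x : Dual) p (Q : Pol) : lform a * Q = a_op G k H p ->
  exists2 Q', lform a * Q' = a_op G k H (lform x * p) &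
    forall xi, a xi *: Q' = a xi *: (lform x * Q)
      + \sum_(g <- pt_stab G H)
         (stab_coef k H g * (x (g^-1%VF xi) - x xi)) *: pol_act g p.
Proof.
move=> aQ.
have [t tP] : exists t : 'End(V) -> R[i],
    forall g, g \in pt_stab G H -> (x \o g^-1)%VF = x + t g *: a.
  (* One function t is chosen for all g; the value 0 outside the stabilizer is a filler. *)
  have /boolp.choice[t tP] (g : 'End(V)) : exists t : R[i],
      g \in pt_stab G H -> (x \o g^-1)%VF = x + t *: a.
    have [gS|gS] := boolP (g \in pt_stab G H); last by exists 0.
    by have [t tE] := pt_stab_quotient gS x; exists t.
  by exists t.
exists (lform x * Q + \sum_(g <- pt_stab G H) (stab_coef k H g * t g) *: pol_act g p).
  rewrite mulrDr mulrCA aQ !a_opE !mulr_sumr -big_split.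
  apply: eq_fbigr => g gS _ /=.
  rewrite (pol_actM g (lform x) p) (pol_act_lform g x) (tP g gS).
  rewrite (lformD x) lformZ mulrDl scalerDr -!scalerAr -!scalerAl scalerA.
  by rewrite [_ * t g]mulrC.
move=> xi; rewrite scalerDr scaler_sumr; congr (_ + _).
apply: eq_fbigr => g gS _ /=; rewrite scalerA mulrCA; congr ((_ * _) *: _).
have /lfunP/(_ xi) := tP g gS.
rewrite comp_lfunE /= => ->; rewrite add_lfunE scale_lfunE.
by rewrite addrAC subrr add0r mulrC.
Qed.

(** Constants have quotient zero, and [a_op_lformM] carries a quotient from p to x p. *)
Lemma a_op_dvd p : exists Q, lform a * Q = a_op G k H p.
Proof.
elim/pol_ind: p => [p q [Q1 e1] [Q2 e2]|c|x p [Q aQ]].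
- by exists (Q1 + Q2); rewrite mulrDr e1 e2 a_opD.
- by exists 0; rewrite mulr0 a_opC.
by have [Q' Q'E _] := a_op_lformM x aQ; exists Q'.
Qed.

Definition quo_op p : Pol := exact_quo (lform a) (a_op G k H p).

Lemma quo_opP p : lform a * quo_op p = a_op G k H p.
Proof.
have [Q aQ] := a_op_dvd p.
by rewrite /quo_op (exact_quoP lform_hyperplane_neq0 aQ).
Qed.

Lemma quo_opD p q : quo_op (p + q) = quo_op p + quo_op q.
Proof.
apply: exact_quoP; first exact: lform_hyperplane_neq0.
rewrite mulrDr a_opD; exact: (congr2 +%R (quo_opP p) (quo_opP q)).
Qed.

Lemma quo_opC c : quo_op c%:MP = 0.
Proof.
apply: exact_quoP; first exact: lform_hyperplane_neq0.
by rewrite mulr0 (a_opC c).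
Qed.

Lemma quo_op_lformM (x : Dual) p xi :
  a xi *: quo_op (lform x * p) = lform x * (a xi *: quo_op p)
      + \sum_(g <- pt_stab G H)
         (stab_coef k H g * (x (g^-1%VF xi) - x xi)) *: pol_act g p.
Proof.
have [Q' Q'E Q'xi] := a_op_lformM x (quo_opP p).
rewrite {1}/quo_op (exact_quoP lform_hyperplane_neq0 Q'E) Q'xi.
by rewrite (scalerAr (a xi) (lform x)).
Qed.
End Hyperplane.
End HyperplaneQuotients.

(** * Dunkl operators *)

Section Dunkl.
Variables (R : realType) (V : vectType R[i]) (dot : {dot V for Num.conj}).
Variable (G : {fset 'End(V)}) (alpha : {vspace V} -> 'Hom(V, R[i]^o)).
Hypothesis subG : subgroupGL G.
Hypothesis unitaryG : forall g, g \in G -> unitary dot g.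
Hypothesis kerA : forall H : {vspace V}, reflection_hyperplane G H -> lker (alpha H) = H.
Local Notation n := (\dim {: V}%VS).
Local Notation Pol := {mpoly R[i][n]}.
Local Notation Dual := 'Hom(V, R[i]^o).

Lemma arrangementP H : H \in arrangement G -> hyperplane H /\ lker (alpha H) = H.
Proof.
rewrite mem_arrangement ?(GL_group1 subG) // => rH; split; last exact: kerA.
by case/andP: rH.
Qed.

Lemma fixedSpace_hyperplane (g : 'End(V)) (H : {vspace V}) :
  hyperplane H -> g != \1%VF -> (H <= fixedSpace g)%VS -> H = fixedSpace g.
Proof.
move=> hH g1 Hg; apply/eqP; rewrite eqEdim Hg /= -ltnS (eqP hH).
rewrite ltn_neqAle dimvS ?subvf // andbT; apply: contra g1 => /eqP d.
have gf : fixedSpace g = fullv by apply/eqP; rewrite eqEdim subvf d /=.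
by apply/eqP/lfunP => x; rewrite lfunE; apply/fixedSpaceP; rewrite gf memvf.
Qed.

(** An element other than the identity that fixes a hyperplane pointwise determines it as its fixed
    space. The identity lies in every stabilizer but contributes zero. *)
Lemma sum_arrangement (M : nmodType) (F : {vspace V} -> 'End(V) -> M) :
  (forall H, F H \1%VF = 0) ->
  \sum_(H <- arrangement G) \sum_(g <- pt_stab G H) F H g =
  \sum_(g <- G) (if hyperplane (fixedSpace g) then F (fixedSpace g) g else 0).
Proof.
move=> F1; under eq_bigr do rewrite /pt_stab big_fset /=.
rewrite (exchange_big_dep predT) //=; apply: eq_fbigr => g gG _.
have [->|g1] := eqVneq g \1%VF.
  by rewrite big1 ?F1 ?if_same.
have [hg|hg] := boolP (hyperplane (fixedSpace g)); last first.
  rewrite big_seq_cond big1 // => H /andP[/arrangementP[hH _] Hg].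
  by rewrite -(fixedSpace_hyperplane hH g1 Hg) hH in hg.
have gA : fixedSpace g \in arrangement G.
  rewrite mem_arrangement ?(GL_group1 subG) // /reflection_hyperplane hg /=.
  apply: contra g1 => /eqP s1.
  have : g \in pt_stab G (fixedSpace g) by apply/pt_stabP.
  by rewrite s1 inE.
rewrite big_mkcond (bigD1_seq (fixedSpace g)) ?fset_uniq //= subvv.
rewrite big_seq_cond big1 ?addr0 // => H /andP[/arrangementP[hH _] /negPf HE].
by case: ifP => // /(fixedSpace_hyperplane hH g1)/eqP; rewrite HE.
Qed.

(** Extension by zero lets the sums run over all of [G], where conjugation and inversion act as
    permutations. *)
Definition refl_coef (k : params V) (g : 'End(V)) : R[i] :=
  if hyperplane (fixedSpace g) then stab_coef G k (fixedSpace g) g else 0.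

Section FixedTuple.
Variable k : params V.
Local Notation T := (dunkl G alpha k).

Lemma dunklE xi p : T xi p = dirderiv xi p
  + \sum_(H <- arrangement G) alpha H xi *: quo_op G (alpha H) H k p.
Proof. by []. Qed.

Lemma dunklD xi p q : T xi (p + q) = T xi p + T xi q.
Proof.
rewrite (dunklE xi (p + q)) (dunklE xi p) (dunklE xi q) dirderivD addrACA.
congr (_ + _); rewrite -big_split; apply: eq_fbigr => H HA _ /=.
have [hH kH] := arrangementP HA.
by rewrite (quo_opD subG unitaryG k hH kH) scalerDr.
Qed.

Lemma dunklC xi c : T xi c%:MP = 0.
Proof.
rewrite dunklE dirderivC add0r big_seq big1 // => H HA.
have [hH kH] := arrangementP HA.
by rewrite (quo_opC subG unitaryG k hH kH) scaler0.
Qed.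

(** The derivative contributes x(xi) p, and the correction terms of the quotients, regrouped by
    reflections, give the last sum. *)
Lemma dunkl_lformM xi (x : Dual) p :
  T xi (lform x * p) = lform x * T xi p + x xi *: p
    + \sum_(g <- G) (refl_coef k g * (x (g^-1%VF xi) - x xi)) *: pol_act g p.
Proof.
have E : \sum_(H <- arrangement G) alpha H xi *: quo_op G (alpha H) H k (lform x * p) =
    \sum_(H <- arrangement G) lform x * (alpha H xi *: quo_op G (alpha H) H k p)
    + \sum_(g <- G) (refl_coef k g * (x (g^-1%VF xi) - x xi)) *: pol_act g p.
  have -> : \sum_(g <- G) (refl_coef k g * (x (g^-1%VF xi) - x xi)) *: pol_act g p =
     \sum_(H <- arrangement G) \sum_(g <- pt_stab G H)
       (stab_coef G k H g * (x (g^-1%VF xi) - x xi)) *: pol_act g p.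
    rewrite (sum_arrangement (F := fun H g =>
      (stab_coef G k H g * (x (g^-1%VF xi) - x xi)) *: pol_act g p)).
      apply: eq_bigr => g _; rewrite /refl_coef.
      by case: ifP => _; rewrite ?mul0r ?scale0r.
    move=> H; rewrite (_ : (\1^-1)%VF = \1%VF) ?lfunE ?subrr ?mulr0 ?scale0r //.
    by apply/esym/(GL_group_invP subG (GL_group1 subG)) => u; rewrite !lfunE.
  rewrite -big_split; apply: eq_fbigr => H HA _.
  have [hH kH] := arrangementP HA.
  exact: (quo_op_lformM subG unitaryG k hH kH).
rewrite [LHS]dunklE [in RHS]dunklE [in LHS]dirderiv_lformM [X in _ + X = _]E.
by rewrite mulrDr [X in _ + X + _ + _]mulr_sumr [LHS]addrACA [LHS]addrA.
Qed.

Lemma dunkl_linear p : linear (fun xi => T xi p).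
Proof.
move=> c u v /=; rewrite (dunklE (c *: u + v) p) (dunklE u p) (dunklE v p).
have E : \sum_(H <- arrangement G) alpha H (c *: u + v) *: quo_op G (alpha H) H k p
   = c *: (\sum_(H <- arrangement G) alpha H u *: quo_op G (alpha H) H k p)
     + \sum_(H <- arrangement G) alpha H v *: quo_op G (alpha H) H k p.
  rewrite scaler_sumr -big_split; apply: eq_bigr => H _ /=.
  by rewrite linearP scalerDl scalerA.
by rewrite [X in _ + X = _]E [dirderiv (c *: u + v) p]dirderiv_is_linear scalerDr addrACA.
Qed.

End FixedTuple.

(** Conjugation moves the fixed hyperplane within its orbit and preserves the order of the
    stabilizer and the determinant. *)
Lemma refl_coef_conj_lfun k h g : h \in G -> g \in G ->
  refl_coef k (conj_lfun h g) = refl_coef k g.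
Proof.
move=> hG gG; rewrite /refl_coef (fixedSpace_conj_lfun subG g hG) (hyperplane_img subG _ hG).
case: (hyperplane (fixedSpace g)); last by [].
rewrite /stab_coef (stab_order_img subG (fixedSpace g) hG); apply: eq_bigr => j _.
by rewrite (orbit_of_img subG (fixedSpace g) hG) (det_conj_lfun subG hG gG).
Qed.

Lemma refl_rank1 g : g \in G -> hyperplane (fixedSpace g) -> 
  exists (a : Dual) v, forall u, g u = u + a u *: v.
Proof.
(* The kernel of [alpha] is prescribed at reflection hyperplanes only, so the identity is treated
   apart. *)
move=> gG hg; have [->|g1] := eqVneq g \1%VF.
  by exists 0, 0 => u; rewrite scaler0 addr0 lfunE.
have rH : reflection_hyperplane G (fixedSpace g).
  rewrite /reflection_hyperplane hg /=; apply: contra g1 => /eqP s1.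
  have : g \in pt_stab G (fixedSpace g) by apply/pt_stabP.
  by rewrite s1 inE.
exists (alpha (fixedSpace g)).
have gS : g \in pt_stab G (fixedSpace g) by apply/pt_stabP.
exact: (pt_stab_rank1 hg (kerA rH) gS).
Qed.

(** Both elements have the same fixed space, and the determinant of a reflection has modulus one, so
    its conjugate is its inverse. *)
Lemma refl_coefV k g : g \in G -> (refl_coef k g)^* = refl_coef (conj_params k) (g^-1)%VF.
Proof.
move=> gG; rewrite /refl_coef (fixedSpaceV subG gG).
have [hg|_] := boolP (hyperplane (fixedSpace g)); last exact: conjC0.
 rewrite /stab_coef rmorph_sum; apply: eq_bigr => j _ /=.
rewrite rmorphM rmorphXn /=; congr (_ * _ ^+ _).
have [a [v gE]] := refl_rank1 gG hg.
rewrite (det_lfunV subG gG); apply: (mulIf (det_lfun_neq0 subG gG)).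
by rewrite (unitary_rank1_det unitaryG gG gE) mulVf // (det_lfun_neq0 subG gG).
Qed.

(* A reflection has rank-one displacement, so the order-two tensor below is
   symmetric; this symmetry makes the Dunkl operators commute. *)
Lemma refl_coef_sym k g (x : Dual) (M : lmodType R[i]) (T : V -> M) xi eta :
  g \in G -> linear T ->
  (refl_coef k g * (x (g^-1%VF eta) - x eta)) *: T (xi - g xi) =
  (refl_coef k g * (x (g^-1%VF xi) - x xi)) *: T (eta - g eta).
Proof.
move=> gG Tlin; rewrite /refl_coef; have [hg|_] := boolP (hyperplane (fixedSpace g));
  last by rewrite !mul0r !scale0r.
have [a [v gE]] := refl_rank1 gG hg.
have TZ c u : T (c *: u) = c *: T u.
  have T0 : T 0 = 0.
    have := Tlin (-1) 0 0; rewrite scaler0 addr0 scaleN1r.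
    by rewrite addrC subrr.
  by have := Tlin c u 0; rewrite addr0 T0 addr0.
have d u : u - g u = - a u *: v by rewrite gE opprD addrA subrr add0r scaleNr.
have dV u : x (g^-1%VF u) - x u = - a u * x (g^-1%VF v).
  have -> : x u = x (g^-1%VF u) + a u * x (g^-1%VF v).
    by rewrite -{1}(GL_groupK subG gG u) gE !linearD !linearZ.
  by rewrite opprD addrA subrr add0r mulNr.
by rewrite !dV !d !TZ !scalerA; congr (_ *: _); ring.
Qed.

End Dunkl.

(** * Formal consequences of the commutation relations *)

Section DunklCalculus.
Variables (R : realType) (V : vectType R[i]) (dot : {dot V for Num.conj}).
Variable G : {fset 'End(V)}.
Hypothesis subG : subgroupGL G.
Hypothesis unitaryG : forall g, g \in G -> unitary dot g.
Variables (P : comAlgType R[i]) (L : V -> P) (act : 'End(V) -> P -> P).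
Hypothesis P_ind : forall K : P -> Prop,
  (forall p q, K p -> K q -> K (p + q)) -> (forall a, K a%:A) ->
  (forall u p, K p -> K (L u * p)) -> forall p, K p.
Hypothesis actD : forall g p q, act g (p + q) = act g p + act g q.
Hypothesis actZ : forall g a p, act g (a *: p) = a *: act g p.
Hypothesis act1 : forall g, act g 1 = 1.
Hypothesis act_L : forall g u p, g \in G -> act g (L u * p) = L (g u) * act g p.
Hypothesis act_comp : forall g h p, g \in G -> h \in G ->
  act g (act h p) = act (g \o h)%VF p.

Hypothesis act_id : forall p, act \1%VF p = p.

Definition displ (g : 'End(V)) (w u : V) : R[i] :=
  inner dot w (g^-1%VF u) - inner dot w u.

Lemma displ_conj h g w u : h \in G -> g \in G ->
  displ (conj_lfun h g) (h w) (h u) = displ g w u.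
Proof.
move=> hG gG; have E : ((conj_lfun h g)^-1)%VF (h u) = h (g^-1%VF u).
  rewrite (conj_lfunV subG hG gG) comp_lfunE comp_lfunE.
  by congr (h (g^-1%VF _)); apply: (GL_groupK subG hG).
by rewrite /displ (congr1 (inner dot (h w)) E) !(inner_group unitaryG _ _ hG).
Qed.

(** Unitarity makes g^-1 the adjoint of g. *)
Lemma displV g w u : g \in G -> (displ (g^-1)%VF w u)^* = displ g u w.
Proof.
move=> gG; rewrite /displ (GL_group_invK subG gG) rmorphB /= !inner_conj.
by rewrite (inner_groupV subG unitaryG _ _ gG).
Qed.

(** An interface that hides the divided differences; the theorem instantiates it both at k and at
    conj k. *)
Record dunkl_rules (c : 'End(V) -> R[i]) (T : V -> P -> P) : Prop := DunklRules {
  drD : forall u p q, T u (p + q) = T u p + T u q;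
  drA : forall u a, T u a%:A = 0;
  drL : forall u w p, T u (L w * p) = L w * T u p + inner dot w u *: p
    + \sum_(g <- G) (c g * displ g w u) *: act g p;
  drlin : forall p, linear (fun u => T u p);
  dr_conj : forall h g, h \in G -> g \in G -> c (conj_lfun h g) = c g;
  dr_sym : forall g w u v p, g \in G ->
    (c g * displ g w v) *: T (u - g u) p = (c g * displ g w u) *: T (v - g v) p }.

Lemma act_sum g (I : choiceType) (A : {fset I}) (F : I -> P) :
  act g (\sum_(i <- A) F i) = \sum_(i <- A) act g (F i).
Proof.
apply: (big_morph (act g) (actD g)).
by have := actZ g 0 0; rewrite !scale0r.
Qed.

Section OneParameter.
Variables (c : 'End(V) -> R[i]) (T : V -> P -> P).
Hypothesis dr : dunkl_rules c T.

Lemma dunkl0r u : T u 0 = 0.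
Proof. by have := drA dr u 0; rewrite scale0r. Qed.

Lemma dunkl_sumr u (I : choiceType) (A : {fset I}) (F : I -> P) :
  T u (\sum_(i <- A) F i) = \sum_(i <- A) T u (F i).
Proof. exact: (big_morph (T u) (drD dr u) (dunkl0r u)). Qed.

Lemma dunkl_scaler u a p : T u (a *: p) = a *: T u p.
Proof.
elim/P_ind: p => [p q IHp IHq|b|w p IH].
- by rewrite scalerDr !(drD dr) IHp IHq scalerDr.
- by rewrite scalerA !(drA dr) scaler0.
rewrite scalerAr !(drL dr) IH !scalerDr scalerAr !scalerA [a * _]mulrC.
congr (_ + _); rewrite scaler_sumr; apply: eq_bigr => g _.
by rewrite actZ !scalerA mulrC.
Qed.

Lemma dunklBl u v p : T (u - v) p = T u p - T v p.
Proof.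
have := drlin dr p (-1) v u; rewrite /= !scaleN1r [- v + u]addrC => ->.
exact: addrC.
Qed.

(** Induction on p: conjugation by h permutes the terms of the sum over the group, while unitarity
    preserves the inner products in them. *)
Lemma dunkl_equivariant h u p : h \in G -> act h (T u p) = T (h u) (act h p).
Proof.
move=> hG; elim/P_ind: p => [p q IHp IHq|a|w p IH].
- by rewrite actD !(drD dr) actD IHp IHq.
- by rewrite actZ act1 !(drA dr); have := actZ h 0 0; rewrite !scale0r.
rewrite (drL dr) !actD act_L // IH actZ act_L // (drL dr) (inner_group unitaryG) //.
congr (_ + _ + _); rewrite act_sum.
rewrite -[RHS](@sum_fset_reindex _ _ _ (conj_lfun h)); last first.
- by move=> g gG; apply: (conj_lfun_in subG).
- by move=> g1 g2 _ _; apply: (conj_lfun_inj subG hG).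
apply: eq_fbigr => g gG _ /=; rewrite actZ (dr_conj dr) //.
rewrite !act_comp ?(conj_lfun_in subG) //.
rewrite (conj_lfunK subG) //; congr ((_ * _) *: _).
exact/esym/displ_conj.
Qed.

Lemma dunkl_comm u v p : T u (T v p) = T v (T u p).
Proof.
elim/P_ind: p => [p q IHp IHq|a|w p IH].
- by rewrite !(drD dr) IHp IHq.
- by rewrite !(drA dr) !dunkl0r.
(* Equivariance moves g past T v', which produces T (g v'). The terms without g are symmetric in u'
   and v', the first one by induction. *)
have expand u' v' : T u' (T v' (L w * p)) = L w * T u' (T v' p)
    + (inner dot w u' *: T v' p + inner dot w v' *: T u' p)
    + \sum_(g <- G) ((c g * displ g w u') *: T (g v') (act g p)
                     + (c g * displ g w v') *: T u' (act g p)).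
  rewrite (drL dr) !(drD dr) (drL dr) dunkl_scaler dunkl_sumr big_split /=.
  have E1 : \sum_(g <- G) (c g * displ g w u') *: act g (T v' p)
      = \sum_(g <- G) (c g * displ g w u') *: T (g v') (act g p).
    by apply: eq_fbigr => g gG _; rewrite dunkl_equivariant.
  have E2 : \sum_(g <- G) T u' ((c g * displ g w v') *: act g p)
      = \sum_(g <- G) (c g * displ g w v') *: T u' (act g p).
    by apply: eq_fbigr => g gG _; rewrite dunkl_scaler.
  by rewrite E1 E2 -!addrA; congr (_ + (_ + _)); rewrite addrCA.
rewrite !expand IH; congr (_ + _ + _); first exact: addrC.
(* For each g the two orders differ by terms in T (u - g u) and T (v - g v), which [dr_sym]
   identifies. *)
apply: eq_fbigr => g gG _; have := dr_sym dr w u v (act g p) gG.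
rewrite !dunklBl !scalerBr => /eqP; rewrite subr_eq => /eqP ->.
by rewrite addrA [_ + (_ - _)]addrC subrK addrC.
Qed.

End OneParameter.

(** These rules determine B by induction on its first argument. *)
Record pairing_rules (T : V -> P -> P) (ev : P -> R[i]) (B : P -> P -> R[i]) : Prop :=
  PairingRules {
  prDl : forall p p' q, B (p + p') q = B p q + B p' q;
  prZl : forall a p q, B (a *: p) q = a^* * B p q;
  prDr : forall p q q', B p (q + q') = B p q + B p q';
  prZr : forall a p q, B p (a *: q) = a * B p q;
  pr1 : forall q, B 1 q = ev q;
  prL : forall u p q, B (L u * p) q = B p (T u q) }.

Variable ev : P -> R[i].
Hypothesis evD : forall p q, ev (p + q) = ev p + ev q.
Hypothesis evA : forall a, ev a%:A = a.
Hypothesis evL : forall u p, ev (L u * p) = 0.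

Lemma ev_act g p : g \in G -> ev (act g p) = ev p.
Proof.
move=> gG; elim/P_ind: p => [p q IHp IHq|a|w p IH].
- by rewrite actD !evD IHp IHq.
- by rewrite actZ act1.
- by rewrite act_L // !evL.
Qed.

(** Equivariance carries g through each operator, down to evaluation at the origin, which is a fixed
    point of g. *)
Lemma pairing_invariant c T B g p q : dunkl_rules c T -> pairing_rules T ev B ->
  g \in G -> B (act g p) (act g q) = B p q.
Proof.
move=> dr pr gG; elim/P_ind: p q => [p p' IHp IHp'|a|u p IH] q.
- by rewrite actD !(prDl pr) IHp IHp'.
- by rewrite actZ act1 !(prZl pr) !(pr1 pr) ev_act.
- by rewrite act_L // !(prL pr) -(dunkl_equivariant dr) // IH.
Qed.

Section TwoParameters.
Variables (c ck : 'End(V) -> R[i]) (T Tk : V -> P -> P) (B Bk : P -> P -> R[i]).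
Hypotheses (dr : dunkl_rules c T) (drk : dunkl_rules ck Tk).
Hypotheses (pr : pairing_rules T ev B) (prk : pairing_rules Tk ev Bk).
Hypothesis c_conj : forall g, g \in G -> (c g)^* = ck (g^-1)%VF.

Lemma pair0r p : B p 0 = 0.
Proof. by have := prZr pr 0 p 0; rewrite scale0r mul0r. Qed.

Lemma pair0l q : B 0 q = 0.
Proof. by have := prZl pr 0 0 q; rewrite scale0r conjC0 mul0r. Qed.

Lemma pair_sumr p (I : choiceType) (A : {fset I}) (F : I -> P) :
  B p (\sum_(i <- A) F i) = \sum_(i <- A) B p (F i).
Proof. exact: (big_morph (B p) (prDr pr p) (pair0r p)). Qed.

Lemma pair_suml q (I : choiceType) (A : {fset I}) (F : I -> P) :
  B (\sum_(i <- A) F i) q = \sum_(i <- A) B (F i) q.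
Proof. exact: (big_morph (B^~ q) (fun p p' => prDl pr p p' q) (pair0l q)). Qed.

Lemma pairing_adjoint u p q : B p (L u * q) = B (Tk u p) q.
Proof.
elim/P_ind: p q => [p p' IHp IHp'|a|w p IH] q.
- by rewrite (drD drk) !(prDl pr) IHp IHp'.
- by rewrite (drA drk) (prZl pr) (pr1 pr) evL mulr0 pair0l.
rewrite (prL pr) (drL dr) (drL drk) !(prDr pr) !(prDl pr) IH.
rewrite (prZr pr) (prZl pr) (prL pr) inner_conj; congr (_ + _ + _).
(* The sums match under inversion: [c_conj] and [displV] relate the coefficients, and invariance
   moves g from the second argument to g^-1 on the first. *)
rewrite pair_sumr pair_suml -[RHS](@sum_fset_reindex _ _ _ (fun g => g^-1)%VF); last first.
- by move=> g; apply: (GL_groupV subG).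
- by move=> g h gG hG e; rewrite -(GL_group_invK subG gG) e (GL_group_invK subG hG).
apply: eq_fbigr => g gG _ /=; have gV := GL_groupV subG gG.
rewrite (prZr pr) (prZl pr) rmorphM /= -c_conj // conjCK displV //.
rewrite -(pairing_invariant p (act g q) dr pr gV) act_comp //.
by rewrite lker0_compVf ?(GL_group_lker0 subG gG) // act_id.
Qed.

Lemma pairing_sym p q : B p q = (Bk q p)^*.
Proof.
elim/P_ind: q p => [q q' IHq IHq'|a|u q IH] p.
- by rewrite (prDr pr) (prDl prk) rmorphD IHq IHq'.
- rewrite (prZl prk) (prZr pr) (pr1 prk) rmorphM /= conjCK; congr (_ * _).
  (* What remains is that B p 1 is the conjugate of ev p. The operators kill 1, and multiples of a
     linear form vanish at the origin. *)
  elim/P_ind: p => [p p' IHp IHp'|b|w p IH].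
  + by rewrite (prDl pr) evD rmorphD IHp IHp'.
  + by rewrite (prZl pr) (pr1 pr) evA -[1]scale1r evA mulr1.
  + by rewrite (prL pr) -[1]scale1r (drA dr) pair0r evL conjC0.
by rewrite pairing_adjoint IH (prL prk).
Qed.

End TwoParameters.
End DunklCalculus.

(** * Evaluating polynomials at commuting operators *)

Lemma linear_fun_sum (F : nzRingType) (U W : lmodType F) (f : U -> W)
    (I : Type) (r : seq I) (a : I -> F) (u : I -> U) : linear f ->
  f (\sum_(i <- r) a i *: u i) = \sum_(i <- r) a i *: f (u i).
Proof.
move=> f_lin; elim: r => [|i r IH]; last by rewrite !big_cons f_lin IH.
rewrite !big_nil; have := f_lin (-1) 0 0.
by rewrite scaler0 addr0 scaleN1r addNr.
Qed.

Section OperatorEvaluation.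
Variables (F : fieldType) (n : nat) (A : lmodType F) (T : 'I_n -> A -> A).
Hypothesis T_linear : forall i, linear (T i).
Hypothesis T_comm : forall i j p, T i (T j p) = T j (T i p).

(** The list of variables is a parameter to permit induction on it. With the full enumeration and
    the Dunkl operators, [op_eval] below unfolds to [dunkl_eval]. *)
Definition mono_apply (m : 'X_{1..n}) (r : seq 'I_n) (p : A) : A :=
  foldr (fun i q => iter (m i) (T i) q) p r.

Definition op_eval (s : {mpoly F[n]}) (p : A) : A :=
  \sum_(m <- msupp s) s@_m *: mono_apply m (enum 'I_n) p.

Lemma mono_apply_linear m r : linear (mono_apply m r).
Proof.
move=> c p q; elim: r => //= i r ->.
by elim: (m i) => //= d ->; apply: T_linear.
Qed.

Lemma op_eval_linear s : linear (op_eval s).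
Proof.
move=> c p q; rewrite /op_eval scaler_sumr -big_split; apply: eq_bigr => m _ /=.
by rewrite mono_apply_linear scalerDr !scalerA mulrC.
Qed.

Lemma op_evalDr s p q : op_eval s (p + q) = op_eval s p + op_eval s q.
Proof. by have := op_eval_linear s 1 p q; rewrite !scale1r. Qed.

Lemma op_evalZr s c p : op_eval s (c *: p) = c *: op_eval s p.
Proof.
have := op_eval_linear s c p 0; rewrite addr0 => ->.
suff -> : op_eval s 0 = 0 by rewrite addr0.
by have := op_eval_linear s (-1) 0 0; rewrite scaler0 addr0 scaleN1r addNr.
Qed.

(** Summing over all monomials below a bound gives several polynomials a common index set, which
    makes additivity in s visible. *)
Lemma op_evalE s k p : (msize s <= k)%N ->
  op_eval s p = \sum_(m : 'X_{1..n < k}) s@_m *: mono_apply m (enum 'I_n) p.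
Proof.
move=> le_sk; pose I : subFinType _ := 'X_{1..n < k}.
rewrite /op_eval (big_mksub I) ?msupp_uniq //=; first last.
  by move=> m /msize_mdeg_lt /leq_trans; apply.
by rewrite big_rmcond //= => m /memN_msupp_eq0 ->; rewrite scale0r.
Qed.

Lemma op_evalDl s t p : op_eval (s + t) p = op_eval s p + op_eval t p.
Proof.
pose k := maxn (msize (s + t)) (maxn (msize s) (msize t)).
rewrite !(@op_evalE _ k) ?leq_max ?leqnn ?orbT // -big_split.
by apply: eq_bigr => m _; rewrite mcoeffD scalerDl.
Qed.

Lemma op_evalZl c s p : op_eval (c *: s) p = c *: op_eval s p.
Proof.
pose k := maxn (msize (c *: s)) (msize s).
rewrite !(@op_evalE _ k) ?leq_max ?leqnn ?orbT // scaler_sumr.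
by apply: eq_bigr => m _; rewrite mcoeffZ scalerA.
Qed.

Lemma op_evalX m p : op_eval 'X_[m] p = mono_apply m (enum 'I_n) p.
Proof. by rewrite /op_eval msuppX big_seq1 mcoeffX eqxx scale1r. Qed.

Lemma op_eval_mpolyC c p : op_eval c%:MP p = c *: p.
Proof.
rewrite -[c%:MP]mulr1 mul_mpolyC op_evalZl -mpolyX0 op_evalX; congr (_ *: _).
by rewrite /mono_apply; elim: (enum _) => //= i r ->; rewrite mnm0E.
Qed.

Lemma mono_apply_comm i m r p : T i (mono_apply m r p) = mono_apply m r (T i p).
Proof.
elim: r => //= j r <-; elim: (m j) => //= d IH.
by rewrite T_comm IH.
Qed.

(** By commutativity the extra factor T i moves inward until it acts on p first; a list without
    repetition meets i at most once. *)
Lemma mono_applyU i m r p : uniq r ->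
  mono_apply (U_(i) + m) r p = mono_apply m r (if i \in r then T i p else p).
Proof.
elim: r => //= j r IH /andP[jr ur]; rewrite IH // mnmDE mnmE in_cons.
have [->|ij] := eqVneq i j; last by rewrite add0n.
by rewrite (negPf jr) add1n iterSr mono_apply_comm.
Qed.

Lemma op_evalXM i s p : op_eval ('X_i * s) p = op_eval s (T i p).
Proof.
elim/mpolyind: s => [|c m s _ _ IH].
  by rewrite mulr0 -mpolyC0 !op_eval_mpolyC !scale0r.
rewrite mulrDr !op_evalDl IH -scalerAr !op_evalZl -mpolyXD !op_evalX.
by rewrite mono_applyU ?enum_uniq // mem_enum.
Qed.

Lemma op_eval_sumr (I : Type) (r : seq I) s (a : I -> F) (p : I -> A) :
  op_eval s (\sum_(i <- r) a i *: p i) = \sum_(i <- r) a i *: op_eval s (p i).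
Proof. exact: (linear_fun_sum _ _ _ (op_eval_linear s)). Qed.

Lemma op_eval_lformM (a : 'I_n -> F) s p :
  op_eval ((\sum_(i < n) a i *: 'X_i) * s) p = op_eval s (\sum_(i < n) a i *: T i p).
Proof.
have op_eval0l : op_eval 0 p = 0 by rewrite -mpolyC0 op_eval_mpolyC scale0r.
have op_evalDl_p s' t : op_eval (s' + t) p = op_eval s' p + op_eval t p.
  exact: op_evalDl.
rewrite op_eval_sumr mulr_suml (big_morph (op_eval^~ p) op_evalDl_p op_eval0l).
by apply: eq_bigr => i _; rewrite -scalerAl op_evalZl op_evalXM.
Qed.

End OperatorEvaluation.

(** * Symmetry of the pairing *)

Section Pairing.
Variables (R : realType) (V : vectType R[i]) (dot : {dot V for Num.conj}).
Variable (G : {fset 'End(V)}) (alpha : {vspace V} -> 'Hom(V, R[i]^o)).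
Hypothesis subG : subgroupGL G.
Hypothesis unitaryG : forall g, g \in G -> unitary dot g.
Hypothesis kerA : forall H : {vspace V}, reflection_hyperplane G H -> lker (alpha H) = H.
Local Notation n := (\dim {: V}%VS).
Local Notation e_ i := (tnth (vbasis {: V}%VS) i).
Local Notation Pol := {mpoly R[i][n]}.
Local Notation L := (fun u : V => lform (inner dot u)).

Lemma pol_act_id (p : Pol) : pol_act \1%VF p = p.
Proof.
have V1 : (\1^-1)%VF = \1%VF :> 'End(V).
  by apply/esym/(GL_group_invP subG (GL_group1 subG)) => u; rewrite !id_lfunE.
elim/pol_ind: p => [p q IHp IHq|c|x p IH].
- by rewrite pol_actD; apply: (congr2 +%R).
- exact: pol_actC.
by rewrite pol_actM pol_act_lform V1 comp_lfun1r; apply: (congr1 ( *%R _)).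
Qed.

Lemma alg_ind (K : Pol -> Prop) :
  (forall p q, K p -> K q -> K (p + q)) -> (forall a, K a%:A) ->
  (forall u p, K p -> K (L u * p)) -> forall p, K p.
Proof.
by move=> KD KA KL; apply: (pol_ind_riesz (dot := dot)) => // c; rewrite -alg_mpolyC.
Qed.

Lemma dunkl_rulesP k :
  dunkl_rules dot G L (@pol_act R V) (refl_coef G k) (dunkl G alpha k).
Proof.
split.
- exact: (dunklD subG unitaryG kerA k).
- by move=> u a; rewrite alg_mpolyC; apply: (dunklC subG unitaryG kerA k).
- move=> u w p; rewrite -(lform_riesz dot w) (dunkl_lformM subG unitaryG kerA).
  rewrite rieszfE; congr (_ + _); apply: eq_bigr => g _.
  by rewrite !rieszfE.
- exact: dunkl_linear.
- exact: (refl_coef_conj_lfun subG).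
move=> g w u v p gG.
have := refl_coef_sym subG kerA k (rieszf dot w) u v gG (dunkl_linear G alpha k p).
by rewrite !rieszfE.
Qed.


Lemma pol_act_one g : pol_act g 1 = 1 :> Pol.
Proof. by have := pol_actC g 1 : pol_act g _ = _ :> Pol; rewrite mpolyC1. Qed.

Lemma pol_act_LM g u (p : Pol) : g \in G -> pol_act g (L u * p) = L (g u) * pol_act g p.
Proof. by move=> gG; rewrite pol_actM (pol_act_riesz subG unitaryG). Qed.

Lemma dunkl_commute k u v p :
  dunkl G alpha k u (dunkl G alpha k v p) = dunkl G alpha k v (dunkl G alpha k u p).
Proof.
apply: (dunkl_comm subG unitaryG (P := Pol) alg_ind _ _ pol_act_one pol_act_LM _ (dunkl_rulesP k)).
- exact: pol_actD.
- exact: pol_actZ.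
- exact: (pol_act_comp subG).
Qed.

Lemma dunklZ k u a p : dunkl G alpha k u (a *: p) = a *: dunkl G alpha k u p.
Proof.
apply: (dunkl_scaler (P := Pol) alg_ind _ (dunkl_rulesP k)).
exact: pol_actZ.
Qed.

Lemma evalA a : (a%:A : Pol).@[fun=> 0] = a.
Proof. by rewrite alg_mpolyC mevalC. Qed.

Lemma eval_LM u (p : Pol) : (L u * p).@[fun=> 0] = 0.
Proof. by rewrite mevalM meval_lform mul0r. Qed.

Section FixedTuple.
Variable k : params V.
Local Notation T := (fun i => dunkl G alpha k (e_ i)).

Lemma dunkl_pol_linear u : linear (dunkl G alpha k u).
Proof.
move=> c p q; rewrite (dunklD subG unitaryG kerA k u (c *: p) q).
exact: (congr1 (+%R^~ _) (dunklZ k u c p)).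
Qed.

(** Linearity of the operators in the direction passes from the basis vectors to an arbitrary u. *)
Lemma op_eval_symvec u s p :
  op_eval T (symvec u * s) p = op_eval T s (dunkl G alpha k u p).
Proof.
have T_lin i : linear (T i) by exact: dunkl_pol_linear.
have T_comm i j q : T i (T j q) = T j (T i q) by exact: dunkl_commute.
rewrite (op_eval_lformM T_lin T_comm) {2}(vec_coordP u).
by rewrite (linear_fun_sum _ _ _ (dunkl_linear G alpha k p)).
Qed.

Lemma pairingE p q :
  pairing dot G alpha k p q = (op_eval T (star_inv dot p) q).@[fun=> 0].
Proof. by []. Qed.

Lemma pairing_rulesP :
  pairing_rules L (dunkl G alpha k) (meval (fun=> 0)) (pairing dot G alpha k).
Proof.
have T_lin i : linear (T i) by exact: dunkl_pol_linear.
split.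
- move=> p p' q; rewrite !pairingE star_invD op_evalDl; exact: mevalD.
- move=> a p q; rewrite !pairingE star_invZ op_evalZl; exact: mevalZ.
- move=> p q q'; rewrite !pairingE (op_evalDr T_lin); exact: mevalD.
- move=> a p q; rewrite !pairingE (op_evalZr T_lin); exact: mevalZ.
- by move=> q; rewrite pairingE star_inv1 -mpolyC1 op_eval_mpolyC scale1r.
- by move=> u p q; rewrite !pairingE star_inv_innerM op_eval_symvec.
Qed.
End FixedTuple.
End Pairing.

Theorem theorem2p18 (R : realType) (V : vectType R[i])
    (dot : {dot V for Num.conj}) (G : {fset 'End(V)})
    (alpha : {vspace V} -> 'Hom(V, R[i]^o)) (k : params V)
    (p q : {mpoly R[i][\dim {: V}%VS]})
    (hG : complex_reflection_group dot G)
    (halpha : forall H : {vspace V},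
       reflection_hyperplane G H -> lker (alpha H) = H) :
  pairing dot G alpha k p q = (pairing dot G alpha (conj_params k) q p)^*.
Proof.
have [subG unitaryG _] := hG.
pose d := dunkl_rulesP subG unitaryG halpha.
pose r := pairing_rulesP subG unitaryG halpha.
have sym := pairing_sym subG unitaryG (@alg_ind R V dot) (@pol_actD R V)
  (@pol_actZ R V) (@pol_act_one R V) (pol_act_LM subG unitaryG)
  (pol_act_comp subG) (pol_act_id subG) (@mevalD _ _ _) (@evalA R V) (eval_LM dot).
(* The remaining goal is the link between the two tuples: conjugate coefficients at g and g^-1. *)
apply: (sym _ _ _ _ _ _ (d k) (d (conj_params k)) (r k) (r (conj_params k))).
exact: (refl_coefV subG unitaryG halpha).
Qed.
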